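(* Let $n=2m+1\ge 3$. The following subcubes of $\{0,1\}^n$ form a tight irreducible subcube partition of size $\Theta(n^3)$: the point $0^n$; all cyclic rotations of $0^m1*^m$; and, for every $0\le i,j,k\le m-1$ with $i+j\le m-1$ and $j+k\le m-1$, the subcube $0^i1*^j0^k1*^{m-1-j-k}0^j1*^{m-1-i-j}$.
   Context: Subcubes of $\{0,1\}^n$ are identified with words in $\{0,1,*\}^n$ (a $*$ at position $i$ means coordinate $i$ is free; exponents denote repetition, e.g. $0^m$ is $m$ zeros). A subcube partition of length $n$ is a partition of $\{0,1\}^n$ into subcubes; its size is the number of subcubes. It is irreducible if no subset $G$ with $1<|G|<|F|$ has a union that is a subcube. It is tight if for every $i\in[n]$ some subcube $s$ in it has $s_i\ne *$. *)

(* Defs.v *)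
From mathcomp Require Import all_boot.
From mathcomp Require Import zify.

Set Implicit Arguments.
Unset Strict Implicit.
Unset Printing Implicit Defensive.

(* Letters of {0,1,*}: [Some b] is the fixed bit [b], [None] is the star. *)
Definition letter := option bool.
Definition zero : letter := Some false.
Definition one : letter := Some true.
Definition star : letter := None.

Definition word (n : nat) := n.-tuple letter.

Definition subcube n (w : word n) : {set n.-tuple bool} :=
  [set x : n.-tuple bool |
    [forall i, (tnth w i == star) || (tnth w i == Some (tnth x i))]].

(* A collection of subcubes is given by its set of words, which is harmless
   since distinct words denote distinct subcubes. *)
Lemma subcube_inj n : injective (@subcube n).
Proof.
move=> v w /setP vw; apply: eq_from_tnth => i.
have mem (u : word n) (x : n.-tuple bool) : x \in subcube u =
    [forall i, (tnth u i == star) || (tnth u i == Some (tnth x i))].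
  by rewrite inE.
pose pt (u : word n) (b : bool) :=
  [tuple if tnth u l is Some c then c else b | l < n].
have ptP u b : pt u b \in subcube u.
  rewrite mem; apply/forallP => l; rewrite tnth_mktuple.
  by case: (tnth u l) => [c|]; rewrite eqxx ?orbT.
have H u u' b : pt u b \in subcube u' ->
    (tnth u' i == star) ||
    (tnth u' i == Some (if tnth u i is Some c then c else b)).
  by rewrite mem => /forallP /(_ i); rewrite tnth_mktuple.
have v0 := H v w false; have v1 := H v w true.
have w0 := H w v false; have w1 := H w v true.
rewrite -vw ptP in v0; rewrite -vw ptP in v1.
rewrite vw ptP in w0; rewrite vw ptP in w1.
move: (v0 isT) (v1 isT) (w0 isT) (w1 isT).
by case: (tnth v i) => [[]|]; case: (tnth w i) => [[]|].
Qed.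

Definition subcube_partition n (F : {set word n}) : Prop :=
  partition [set subcube s | s in F] [set: n.-tuple bool].

Definition irreducible n (F : {set word n}) : Prop :=
  forall G : {set word n}, G \subset F -> 1 < #|G| < #|F| ->
    ~ exists w : word n, \bigcup_(s in G) subcube s = subcube w.

Definition tight n (F : {set word n}) : Prop :=
  forall i : 'I_n, exists2 s : word n, s \in F & tnth s i != star.

Definition rotation_word (m : nat) : seq letter :=
  nseq m zero ++ one :: nseq m star.

Definition triple_word (m i j k : nat) : seq letter :=
  nseq i zero ++ one :: nseq j star ++ nseq k zero ++
  one :: nseq (m - 1 - j - k) star ++ nseq j zero ++
  one :: nseq (m - 1 - i - j) star.

Definition cubic_family (m : nat) : {set word (2 * m + 1)} :=
  [set w : word (2 * m + 1) |
    [|| tval w == nseq (2 * m + 1) zero,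
        [exists r : 'I_(2 * m + 1), tval w == rot r (rotation_word m)]
      | [exists i : 'I_m, exists j : 'I_m, exists k : 'I_m,
          [&& i + j <= m - 1, j + k <= m - 1
            & tval w == triple_word m i j k]]]].

(* [cubic_family] tests words of length [2 * m + 1] for membership; by the two
   length computations below no listed word is lost. *)
Lemma size_rotation_word m : size (rotation_word m) = 2 * m + 1.
Proof. by rewrite /rotation_word size_cat /= !size_nseq; lia. Qed.

Lemma size_triple_word m i j k : i < m -> i + j <= m - 1 -> j + k <= m - 1 ->
  size (triple_word m i j k) = 2 * m + 1.
Proof.
rewrite /triple_word => ? ? ?.
by do 4! rewrite ?size_cat ?size_nseq /=; lia.
Qed.

(* Main.v *)
From Pilot Require Import Defs.
From mathcomp Require Import all_boot all_order all_algebra.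
From mathcomp Require Import all_classical all_reals all_analysis.
From mathcomp Require Import zify.
Import numFieldNormedType.Exports.
Import Pilot.Defs.

(* Read a nonzero point x as a cyclic word of length 2m+1. If x has a cyclic run of m
   zeros followed by a one, that one is unique and x lies in exactly one
   rotation. Otherwise let p1 be the first one of x, p3 the first one at or
   after p1+m+1, and p2 the first one at or after p3-m: these are the three ones
   of the only triple word that matches x.
   For irreducibility, let w be a subcube that is a union of members. Every star
   of a member that meets w is a star of w. If w has no fixed one and some star
   at q, the rotation with its one at q makes the next m positions stars, and so
   on around the cycle. Otherwise the point of w with zeros at all stars lies in
   a member c whose ones are exactly the ones of w; were a zero q of c free in w,
   adding a one at q would give a point of w whose member keeps all the ones of c
   and hence is c itself, which is absurd. *)

Set Implicit Arguments.
Unset Strict Implicit.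
Unset Printing Implicit Defensive.

(* [Rot p] is the rotation whose one is at position [p]. *)
Inductive code := Zero | Rot of nat | Trip of nat & nat & nat.

Definition valid m (c : code) : bool :=
  match c with
  | Zero => true
  | Rot p => p <= 2 * m
  | Trip i j k => (i + j < m) && (j + k < m)
  end.

(** In [Rot p] the clause [p + m < q] covers those of the m zeros before p that wrap past position
    0. In [Trip i j k] the three ones are the p1, p2, p3 of the overview. *)
Definition code_letter m (c : code) (q : nat) : letter :=
  match c with
  | Zero => zero
  | Rot p =>
      if q == p then one
      else if (q < p <= q + m) || (p + m < q) then zero else star
  | Trip i j k =>
      if [|| q == i, q == i + j + k + 1 | q == i + m + j + 1] then one
      else if [|| q < i, i + j < q <= i + j + k | i + m < q <= i + m + j]
      then zero else star
  end.

(** Words and points are functions on [nat] here, so that positions shift freely and their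
    comparisons go to [lia]. *)
Definition fits n (w : nat -> letter) (x : nat -> bool) :=
  forall q, q < n -> w q = star \/ w q = Some (x q).

(** * Covering, uniqueness and saturated subcubes, on codes *)

Section Codes.
Variable m : nat.
Hypothesis m_gt0 : 0 < m.
Local Notation n := (2 * m + 1).

Lemma fits_one w x q : fits n w x -> q < n -> w q = one -> x q = true.
Proof. by move=> fx /fx[] -> // [->]. Qed.

Lemma fits_zero w x q : fits n w x -> q < n -> w q = zero -> x q = false.
Proof. by move=> fx /fx[] -> // [->]. Qed.

Lemma code_cover x : exists2 c, valid m c & fits n (code_letter m c) x.
Proof.
have first a : (exists2 p, a <= p < n & x p /\ forall q, a <= q < p -> x q = false)
    \/ (forall q, a <= q < n -> x q = false).
  case: (boolP (has x (index_iota a n))) => [/hasP[p0] | /hasPn no]; last first.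
    by right=> q aq; apply/negbTE/no; rewrite mem_index_iota.
  rewrite mem_index_iota => ap0 xp0; left.
  have ex : exists p, [&& a <= p, p < n & x p] by exists p0; rewrite andbA ap0.
  case: (ex_minnP ex) => p /and3P[ap pn xp] pmin.
  exists p; first by rewrite ap.
  split=> // q /andP[aq qp]; apply/negP => xq.
  by have := pmin q; rewrite aq xq (ltn_trans qp pn) => /(_ isT); lia.
have [[p1 p1n [x1 z1]]|z1] := first 0; last first.
  by exists Zero => // q qn; right; rewrite /= z1.
have [[p3 p3n [x3 z3]]|z3] := first (p1 + m + 1); last first.
  exists (Rot p1) => [/=|q qn /=]; first by lia.
  have [->|_] := eqVneq q p1; first by rewrite x1; right.
  case: ifP => h; [right|by left].
  by have [qp|qp] := ltnP q p1; [rewrite z1|rewrite z3] => //; lia.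
have [[p2 p2n [x2 z2]]|z2] := first (p3 - m); last by move: x3; rewrite z2 //; lia.
(* If p2 is not before p3, the m positions before p3 are all zero. They do not wrap, since p3 >
   m. *)
have [p23|p23] := ltnP p2 p3; last first.
  exists (Rot p3) => [/=|q qn /=]; first by lia.
  have [->|_] := eqVneq q p3; first by rewrite x3; right.
  case: ifP => h; [right|by left].
  by rewrite z2 //; lia.
have p21 : p2 <= p1 + m.
  by rewrite leqNgt; apply/negP => h; move: x2; rewrite z3 //; lia.
(* These parameters solve p1 = i, p3 = i + m + j + 1 and p2 = i + j + k + 1. The three zero blocks
   below come from the minimality of p1, p2 and p3 respectively. *)
exists (Trip p1 (p3 - p1 - m - 1) (p2 - (p3 - m))) => [/=|q qn /=]; first by lia.
case: ifP => h1.
  right; have [->|[->|->]] : q = p1 \/ q = p2 \/ q = p3 by lia.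
  - by rewrite x1.
  - by rewrite x2.
  by rewrite x3.
case: ifP => h2; [right|by left].
have [h|[h|h]] : q < p1 \/ p3 - m <= q < p2 \/ p1 + m + 1 <= q < p3 by lia.
- by rewrite z1.
- by rewrite z2.
by rewrite z3 //; lia.
Qed.

Lemma fits_rot p x : p < n -> fits n (code_letter m (Rot p)) x ->
  x p /\ forall q, q < n -> x q -> ~~ ((q < p <= q + m) || (p + m < q)).
Proof.
move=> pn fx; split=> [|q qn xq].
  by rewrite (fits_one fx) //= eqxx.
apply/negP => h; have := fits_zero fx qn; rewrite /= h xq.
by case: eqP => [|_ /(_ erefl)] //; lia.
Qed.

Lemma fits_trip i j k x : valid m (Trip i j k) ->
  fits n (code_letter m (Trip i j k)) x ->
  [/\ x i, x (i + j + k + 1), x (i + m + j + 1) &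
    forall q, q < n -> x q ->
      ~~ [|| q < i, i + j < q <= i + j + k | i + m < q <= i + m + j]].
Proof.
move=> /= v fx.
split=> [|||q qn xq]; try by rewrite (fits_one fx) //= ?eqxx ?orbT //; lia.
apply/negP => h; have := fits_zero fx qn; rewrite /= h xq.
by case: ifP => [|_ /(_ erefl)] //; lia.
Qed.

(** Every one of x avoids the zero blocks of both codes, so the ones of each code are tested against
    the blocks of the other. *)
Lemma code_unique x c d : valid m c -> valid m d ->
  fits n (code_letter m c) x -> fits n (code_letter m d) x -> c = d.
Proof.
have zero_false q : fits n (code_letter m Zero) x -> q < n -> x q -> False.
  by move=> /[apply] -[] // [<-].
(* The cyclic gaps between the ones of a triple are j + k + 1, m - k and m - j, all at most m, which
   leaves no room for m consecutive zeros. *)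
have rot_trip p i j k : valid m (Rot p) -> valid m (Trip i j k) ->
    fits n (code_letter m (Rot p)) x ->
    fits n (code_letter m (Trip i j k)) x -> False.
  move=> vp vt /fits_rot[|xp zp]; first by move: vp => /=; lia.
  move=> /(fits_trip vt)[/zp h1 /zp h2 /zp h3 _]; move: vp vt h1 h2 h3 => /=.
  by lia.
case: c => [|p|i j k]; case: d => [|q|i' j' k'] vc vd fc fd //.
- have [|xq _] := fits_rot _ fd; first by move: vd => /=; lia.
  by case: (zero_false q fc) => //; move: vd => /=; lia.
- have [xq _ _ _] := fits_trip vd fd.
  by case: (zero_false i' fc) => //; move: vd => /=; lia.
- have [|xq _] := fits_rot _ fc; first by move: vc => /=; lia.
  by case: (zero_false p fd) => //; move: vc => /=; lia.
(* Of two distinct positions on a cycle of length 2m+1, one is among the m positions before the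
   other. *)
- have [|xp zp] := fits_rot _ fc; first by move: vc => /=; lia.
  have [|xq zq] := fits_rot _ fd; first by move: vd => /=; lia.
  move: (zp q ^~ xq) (zq p ^~ xp) vc vd => /= h1 h2 h3 h4.
  by congr Rot; lia.
- by case: (rot_trip p i' j' k').
- have [xq _ _ _] := fits_trip vc fc.
  by case: (zero_false i fd) => //; move: vc => /=; lia.
- by case: (rot_trip q i j k).
- have [x1 x2 x3 z] := fits_trip vc fc.
  have [x1' x2' x3' z'] := fits_trip vd fd.
  move: (z' _ ^~ x1) (z' _ ^~ x2) (z' _ ^~ x3) => {z' x1 x2 x3}.
  move: (z _ ^~ x1') (z _ ^~ x2') (z _ ^~ x3') => {z x1' x2' x3'}.
  move: vc vd => /= vc vd h1 h2 h3 h4 h5 h6.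
  (* i is the first one of x; then j is read off the first one from i + m + 1 on, and k off the
     first one from i + j + 1 on. *)
  have e1 : i = i' by lia.
  have e2 : j = j' by lia.
  by congr Trip => //; lia.
Qed.

Lemma rot_oneP p q : code_letter m (Rot p) q = one <-> q = p.
Proof. by rewrite /=; split=> [|->]; [case: eqP => // _; case: ifP|rewrite eqxx]. Qed.

Lemma trip_oneP i j k q : code_letter m (Trip i j k) q = one <->
  [\/ q = i, q = i + j + k + 1 | q = i + m + j + 1].
Proof.
rewrite /=; split=> [|h]; last by case: ifP => //; case: h; lia.
case: ifP => [h _|_]; last by case: ifP.
by case/or3P: h => /eqP; [apply: Or31|apply: Or32|apply: Or33].
Qed.

(* [w] is a subcube that contains every member of the family that it meets;
   then the free coordinates of such a member are free in [w]. *)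
Lemma saturated_subcube w :
    (forall c x q, valid m c -> fits n (code_letter m c) x -> fits n w x ->
       q < n -> code_letter m c q = star -> w q = star) ->
  (forall q, q < n -> w q = star) \/
  exists2 c, valid m c & forall q, q < n -> w q = code_letter m c q.
Proof.
move=> sat.
have [/hasP[p1]|/hasPn no1] := boolP (has (fun q => w q == one) (iota 0 n)).
  rewrite mem_iota => /= p1n /eqP w1; right.
  have wx : fits n w (fun q => w q == one).
    by move=> q _; case: (w q) => [[]|]; [right|right|left].
  have [c vc fc] := code_cover (fun q => w q == one).
  have one_wq q : q < n -> code_letter m c q = one -> w q = one.
    by move=> qn /(fits_one fc qn) /eqP.
  (* A one of w cannot be a star of c, since [sat] would make it a star of w. *)
  have one_cq q : q < n -> w q = one -> code_letter m c q = one.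
    move=> qn wq; have := sat c _ q vc fc wx qn.
    by case: (fc q qn) => -> //; rewrite wq ?eqxx // => /(_ erefl).
  exists c => // q qn.
  case E : (code_letter m c q) => [[]|]; [exact: one_wq| |exact: (sat c _ q vc fc wx)].
  have /eqP nq := fits_zero fc qn E.
  case W : (w q) nq => [[]|] // _; exfalso.
  pose y r := (w r == one) || (r == q).
  have wy : fits n w y.
    move=> r _; rewrite /y; have [->|_] := eqVneq r q; first by left.
    by rewrite orbF; case: (w r) => [[]|]; [right|right|left].
  have [d vd fd] := code_cover y.
  have one_dr r : r < n -> code_letter m c r = one ->
      code_letter m d r = one.
    move=> rn /(one_wq r rn) wr; have := sat d y r vd fd wy rn.
    by case: (fd r rn) => -> //; rewrite /y wr ?eqxx // => /(_ erefl).
  have y_one r : r < n -> y r -> code_letter m c r = one \/ r = q.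
    by move=> rn /orP[/eqP /(one_cq r rn)|/eqP]; [left|right].
  have nq0 : code_letter m d q <> zero.
    by move=> /(fits_zero fd qn); rewrite /y eqxx orbT.
  case: c vc E one_dr y_one {fc one_wq} one_cq => [|p|i j k] vc E one_dr y_one one_cq.
  - by have := one_cq p1 p1n w1.
  - have pn : p < n by move: vc => /=; lia.
    have := one_dr p pn (proj2 (rot_oneP p p) erefl).
    case: d vd fd nq0 {one_dr} => [//|p'|i' j' k'] vd fd nq0.
      by move=> /rot_oneP e; case: nq0; rewrite -e.
    (* The three distinct ones of the triple would all have to lie in {p, q}. *)
    move=> _; have [x1 x2 x3 _] := fits_trip vd fd.
    move: vd => /= vd.
    have b1 : i' < n by lia.
    have b2 : i' + j' + k' + 1 < n by lia.
    have b3 : i' + m + j' + 1 < n by lia.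
    case: (y_one _ b1 x1) => [/rot_oneP|]; case: (y_one _ b2 x2) => [/rot_oneP|];
      by case: (y_one _ b3 x3) => [/rot_oneP|]; lia.
  (* The three ones of c are ones of d, so d is a triple with the same parameters; but d has no zero
     at q. *)
  have ones : forall r, [\/ r = i, r = i + j + k + 1 | r = i + m + j + 1] ->
      code_letter m d r = one.
    move=> r h; apply: one_dr; last exact/trip_oneP.
    by move: vc h => /= vc []; lia.
  have := ones _ (Or31 _ _ erefl).
  have := ones _ (Or32 _ _ erefl).
  have := ones _ (Or33 _ _ erefl).
  case: d vd nq0 {fd one_dr ones} => [//|p'|i' j' k'] vd nq0.
    by move=> /rot_oneP + /rot_oneP + /rot_oneP; lia.
  move=> /trip_oneP h1 /trip_oneP h2 /trip_oneP h3.
  move: vc vd => /= vc vd.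
  have e1 : i = i' by case: h1; case: h2; case: h3; lia.
  have e2 : j = j' by case: h1; case: h2; case: h3; lia.
  have e3 : k = k' by case: h1; case: h2; case: h3; lia.
  by case: nq0; rewrite -e1 -e2 -e3.
have [/hasP[p0]|/hasPn no_star] := boolP (has (fun q => w q == star) (iota 0 n)); last first.
  right; exists Zero => // q qn.
  have := no1 q; have := no_star q; rewrite mem_iota qn /= => /(_ isT) + /(_ isT).
  by case: (w q) => [[]|].
rewrite mem_iota => /= p0n /eqP wp0; left.
(* As w has no fixed one and is free at q, the point whose only one is at q lies in w; its member is
   [Rot q]. *)
have step q r : q < n -> r < n -> w q = star ->
    code_letter m (Rot q) r = star -> w r = star.
  move=> qn rn wq; apply: (sat (Rot q) (fun r => r == q)) => //=.
  - by lia.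
  - move=> s _ /=; case: ifP => _; first by right.
    by case: ifP => _; [right|left].
  move=> s sn; have := no1 s; rewrite mem_iota sn => /(_ isT).
  have [->|_] := eqVneq s q; first by left.
  by case: (w s) => [[]|] // _; [right|left].
(* Since m > 0, [Rot q] has a star at the cyclically next position. Stars thus spread upwards one by
   one, and [w0] wraps them from 2m to 0. *)
have up q d : q + d < n -> w q = star -> w (q + d) = star.
  elim: d => [|d IH] h wq; first by rewrite addn0.
  apply: (step (q + d)) => //; try lia.
    by apply: IH => //; lia.
  by rewrite /=; case: ifP => [|_]; [lia | case: ifP => //; lia].
have w0 : w 0 = star.
  apply: (step (2 * m)); try lia.
    by have := up p0 (2 * m - p0); rewrite subnKC; [apply=> // | ]; lia.
  by rewrite /=; case: ifP => [|_]; [lia | case: ifP => //; lia].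
by move=> q qn; apply: (up 0).
Qed.
End Codes.

(** * Identifying the words of the family with the valid codes *)

Definition code_word m c : word (2 * m + 1) :=
  [tuple of mkseq (code_letter m c) (2 * m + 1)].

Lemma nth_code_word m c q : q < 2 * m + 1 ->
  nth star (code_word m c) q = code_letter m c q.
Proof. exact: nth_mkseq. Qed.

(** [rot] shifts to the left, so the one moves from m to m - r, modulo 2m+1. *)
Lemma rot_rotation_word m r : r < 2 * m + 1 ->
  rot r (rotation_word m) =
  code_word m (Rot (if r <= m then m - r else 3 * m + 1 - r)).
Proof.
move=> rn; apply: (@eq_from_nth _ star) => [|q].
  by rewrite size_rot size_rotation_word size_tuple.
rewrite size_rot size_rotation_word => qn; rewrite nth_code_word //.
rewrite /rot nth_cat size_drop size_rotation_word nth_drop.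
have nth_rw s : s < 2 * m + 1 -> nth star (rotation_word m) s =
    if s < m then zero else if s == m then one else star.
  move=> sn; rewrite nth_cat size_nseq nth_nseq.
  have [sm|sm|->] := ltngtP s m => //; last by rewrite subnn.
  by rewrite -[s - m]prednK /= ?nth_nseq ?if_same //; lia.
have -> : (if q < 2 * m + 1 - r then nth star (rotation_word m) (r + q)
    else nth star (take r (rotation_word m)) (q - (2 * m + 1 - r))) =
    nth star (rotation_word m)
      (if q < 2 * m + 1 - r then r + q else q - (2 * m + 1 - r)).
  by case: ifP => // h; rewrite nth_take //; lia.
rewrite nth_rw /=; last by case: ifP; lia.
by have [rm|rm] := leqP r m; have [qr|qr] := ltnP q (2 * m + 1 - r);
  do ![case: ifP => ? //]; lia.
Qed.

Lemma triple_code_word m i j k : valid m (Trip i j k) ->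
  triple_word m i j k = code_word m (Trip i j k).
Proof.
move=> /= v; apply: (@eq_from_nth _ star) => [|q].
  by rewrite size_triple_word ?size_tuple; lia.
rewrite size_triple_word; try lia.
move=> qn; rewrite nth_code_word // /triple_word.
have nth_block a (l : letter) s t : nth star (nseq a l ++ s) t =
    if t < a then l else nth star s (t - a).
  by rewrite nth_cat size_nseq nth_nseq; have [] := ltnP t a.
have nth_one s t : nth star (one :: s) t =
    if t == 0 then one else nth star s (t - 1).
  by case: t => [//|t]; rewrite subn1.
rewrite !(nth_block, nth_one) nth_nseq if_same /=.
by do ![case: ifP => ? //]; lia.
Qed.

Lemma zero_code_word m : nseq (2 * m + 1) zero = code_word m Zero.
Proof.
apply: (@eq_from_nth _ star); rewrite size_nseq ?size_tuple // => q qn.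
by rewrite nth_code_word // nth_nseq qn.
Qed.

Lemma mem_cubic_family m (w : word (2 * m + 1)) :
  w \in cubic_family m <-> exists2 c, valid m c & w = code_word m c.
Proof.
rewrite inE; split=> [/or3P[/eqP e|/existsP[r /eqP e]|]|[c vc ->]].
- by exists Zero => //; apply/val_inj; rewrite /= e zero_code_word.
- exists (Rot (if r <= m then m - r else 3 * m + 1 - r)).
    by rewrite /=; have := ltn_ord r; case: ifP; lia.
  by apply/val_inj; rewrite /= e rot_rotation_word.
- move=> /existsP[i /existsP[j /existsP[k /and3P[ij jk /eqP e]]]].
  have v : valid m (Trip i j k) by rewrite /=; have := ltn_ord i; lia.
  by exists (Trip i j k) => //; apply/val_inj; rewrite /= e triple_code_word.
case: c vc => [_|p vp|i j k v].
- by rewrite zero_code_word eqxx.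
- apply/or3P/Or32/existsP.
  (* The map from r to the position of the one is an involution, so the same formula recovers r from
     p. *)
  have rn : (if p <= m then m - p else 3 * m + 1 - p) < 2 * m + 1.
    by move: vp => /=; case: ifP; lia.
  exists (Ordinal rn); rewrite rot_rotation_word //=; apply/eqP.
  congr (mkseq (code_letter m (Rot _)) _).
  by move: vp => /=; have [h|h] := leqP p m; case: ifP; lia.
move: (v) => /= v'.
apply/or3P/Or33/existsP.
have im : i < m by lia.
have jm : j < m by lia.
have km : k < m by lia.
exists (Ordinal im); apply/existsP; exists (Ordinal jm); apply/existsP.
by exists (Ordinal km); rewrite /= triple_code_word // eqxx andbT; lia.
Qed.

Lemma mem_subcube n (w : word n) (x : n.-tuple bool) :
  x \in subcube w <-> fits n (nth star w) (nth false x).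
Proof.
rewrite inE; split=> [/forallP h q qn|h].
  have /orP := h (Ordinal qn); rewrite !(tnth_nth star, tnth_nth false) /=.
  by case=> /eqP ->; [left|right].
apply/forallP => i; rewrite (tnth_nth star) (tnth_nth false).
by have [->|->] := h i (ltn_ord i); rewrite eqxx ?orbT.
Qed.

Lemma mem_code_word m c (x : (2 * m + 1).-tuple bool) :
  x \in subcube (code_word m c) <->
  fits (2 * m + 1) (code_letter m c) (nth false x).
Proof.
by rewrite mem_subcube; split=> h q qn; move: (h q qn); rewrite nth_code_word.
Qed.

Lemma eq_fits n w x y : (forall q, q < n -> x q = y q) -> fits n w x -> fits n w y.
Proof. by move=> xy fx q qn; rewrite -xy //; apply: fx. Qed.

Lemma fits_point m c : fits (2 * m + 1) (code_letter m c)
  (fun q => code_letter m c q == one).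
Proof. by move=> q _; case: (code_letter m c q) => [[]|]; [right|right|left]. Qed.

Lemma code_word_point m c : exists x, x \in subcube (code_word m c).
Proof.
exists [tuple of mkseq (fun q => code_letter m c q == one) (2 * m + 1)].
apply/mem_code_word/(eq_fits _ (fits_point c)) => q qn.
by rewrite nth_mkseq.
Qed.

(** * Partition, tightness and irreducibility *)

Lemma cubic_family_cover m (x : (2 * m + 1).-tuple bool) : 0 < m ->
  exists2 s, s \in cubic_family m & x \in subcube s.
Proof.
move=> m0; have [c vc fc] := code_cover m0 (nth false x).
by exists (code_word m c); [apply/mem_cubic_family; exists c | apply/mem_code_word].
Qed.

Lemma cubic_family_unique m s t (x : (2 * m + 1).-tuple bool) : 0 < m ->
  s \in cubic_family m -> t \in cubic_family m ->
  x \in subcube s -> x \in subcube t -> s = t.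
Proof.
move=> m0 /mem_cubic_family[c vc ->] /mem_cubic_family[d vd ->].
by move=> /mem_code_word fc /mem_code_word fd; rewrite (code_unique m0 vc vd fc fd).
Qed.

Lemma cubic_family_nonempty m s : s \in cubic_family m -> exists x, x \in subcube s.
Proof. by move=> /mem_cubic_family[c _ ->]; apply: code_word_point. Qed.

Lemma cubic_family_partition m : 0 < m -> subcube_partition (cubic_family m).
Proof.
move=> m0; apply/and3P; split.
- apply/eqP/setP => x; rewrite inE; apply/bigcupP.
  have [s sF xs] := cubic_family_cover x m0.
  by exists (subcube s) => //; apply: imset_f.
- apply/finset.trivIsetP => _ _ /imsetP[s sF ->] /imsetP[t tF ->] st.
  rewrite -setI_eq0; apply/finset.set0Pn => -[x /setIP[xs xt]].
  by move: st; rewrite (cubic_family_unique m0 sF tF xs xt) eqxx.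
apply/imsetP => -[s /cubic_family_nonempty[x xs] e].
by rewrite -e inE in xs.
Qed.

Lemma cubic_family_tight m : tight (cubic_family m).
Proof.
move=> i; exists (code_word m (Rot i)).
  by apply/mem_cubic_family; exists (Rot i) => //=; have := ltn_ord i; lia.
by rewrite (tnth_nth star) nth_code_word //= eqxx.
Qed.

Lemma cubic_family_irreducible m : 0 < m -> irreducible (cubic_family m).
Proof.
move=> m0 G /fintype.subsetP GF /andP[G1 GlF] [w Gw].
have memG s x : s \in G -> x \in subcube s -> fits (2 * m + 1) (nth star w) (nth false x).
  by move=> sG xs; apply/mem_subcube; rewrite -Gw; apply/bigcupP; exists s.
have [|all_star|[c vc wc]] := saturated_subcube m0 (w := nth star w).
- move=> c x q vc fc fw qn cq.
  pose X : (2 * m + 1).-tuple bool := [tuple of mkseq x (2 * m + 1)].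
  have xX r : r < 2 * m + 1 -> x r = nth false X r by move=> rn; rewrite nth_mkseq.
  have : X \in subcube w by apply/mem_subcube/(eq_fits xX fw).
  rewrite -Gw => /bigcupP[s sG Xs].
  have cF : code_word m c \in cubic_family m by apply/mem_cubic_family; exists c.
  have Xc : X \in subcube (code_word m c) by apply/mem_code_word/(eq_fits xX fc).
  have sE := cubic_family_unique m0 (GF _ sG) cF Xs Xc.
  (* Flipping x at a star q of c stays in c, which belongs to G, hence stays in w; so w cannot fix
     coordinate q. *)
  pose y r := if r == q then ~~ x r else x r.
  pose Y : (2 * m + 1).-tuple bool := [tuple of mkseq y (2 * m + 1)].
  have yY r : r < 2 * m + 1 -> y r = nth false Y r by move=> rn; rewrite nth_mkseq.
  have Ys : Y \in subcube s.
    rewrite sE; apply/mem_code_word/(eq_fits yY) => r rn; rewrite /y.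
    by have [->|_] := eqVneq r q; [left|apply: fc].
  have := memG s Y sG Ys q qn; rewrite -yY // /y eqxx.
  by have [->|->] := fw q qn; [|case=> // -[]; case: (x q)].
(* Here w is the whole cube, which forces G to be the whole family. *)
- move: GlF; rewrite ltnNge => /negP; apply; apply/subset_leq_card/fintype.subsetP => s sF.
  have [x xs] := cubic_family_nonempty sF.
  have : x \in subcube w by apply/mem_subcube => q qn; left; apply: all_star.
  rewrite -Gw => /bigcupP[t tG xt].
  by rewrite (cubic_family_unique m0 sF (GF _ tG) xs xt).
(* Here w is a single member, and by disjointness G contains no other. *)
move: G1; rewrite ltnNge => /negP; apply.
apply: leq_trans (_ : #|[set code_word m c]| <= 1); last by rewrite cards1.
apply/subset_leq_card/fintype.subsetP => s sG.
have [x xs] := cubic_family_nonempty (GF _ sG).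
rewrite inE; apply/eqP; apply: (cubic_family_unique (x := x)) => //; first exact: GF.
  by apply/mem_cubic_family; exists c.
by apply/mem_code_word => q qn; rewrite -wc //; apply: memG xs q qn.
Qed.

(** * Cubic bounds on the size *)

Lemma card_cubic_family_le m : 0 < m -> #|cubic_family m| <= 3 * (2 * m + 1) ^ 3.
Proof.
move=> m0; pose T : finType := option ('I_(2 * m + 1) + 'I_m * 'I_m * 'I_m)%type.
pose f (t : T) := code_word m (match t with
  | None => Zero
  | Some (inl p) => Rot p
  | Some (inr (i, j, k)) => Trip i j k
  end).
have FT : cubic_family m \subset [set f t | t in T].
  apply/fintype.subsetP => _ /mem_cubic_family[c vc ->]; apply/imsetP.
  case: c vc => [_|p|i j k] /=; first by exists None.
    rewrite -ltnS -[(2 * m).+1]addn1 => pn.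
    by exists (Some (inl (Ordinal pn))).
  move=> v; have im : i < m by lia.
  have jm : j < m by lia.
  have km : k < m by lia.
  by exists (Some (inr (Ordinal im, Ordinal jm, Ordinal km))).
apply: leq_trans (subset_leq_card FT) _; apply: leq_trans (leq_imset_card _ _) _.
(* The count is 1 + n + m^3 with n = 2m+1, and each summand is at most n^3. *)
rewrite card_option card_sum !card_prod !card_ord.
nia.
Qed.

(** With h the upper half of m, all i, j, k < h give valid triples, since 2(h - 1) < m. These are
    h^3 distinct members, and 2m+1 <= 6h yields the constant 216 = 6^3. *)
Lemma card_cubic_family_ge m : 0 < m -> (2 * m + 1) ^ 3 <= 216 * #|cubic_family m|.
Proof.
move=> m0; pose h := uphalf m.
pose f (t : 'I_h * 'I_h * 'I_h) := code_word m (Trip t.1.1 t.1.2 t.2).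
have v (t : 'I_h * 'I_h * 'I_h) : valid m (Trip t.1.1 t.1.2 t.2).
  case: t => [[i j] k] /=; have := ltn_ord i; have := ltn_ord j; have := ltn_ord k.
  by rewrite /h; lia.
have f_inj : injective f.
  move=> t u tu; have [x] := code_word_point m (Trip t.1.1 t.1.2 t.2).
  move=> xt; have := xt; rewrite -/(f t) tu => /mem_code_word xu.
  move/mem_code_word: xt => /(code_unique m0 (v t) (v u))/(_ xu).
  case: t u {tu xu} => [[i j] k] [[i' j'] k'] /= [].
  by do 3!move/val_inj ->.
have : [set f t | t in predT] \subset cubic_family m.
  by apply/fintype.subsetP => _ /imsetP[t _ ->]; apply/mem_cubic_family; eexists; [apply: v|].
move=> /subset_leq_card; rewrite card_imset // !card_prod card_ord => hF.
have hm : 2 * m + 1 <= 6 * h by rewrite /h; lia.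
have : (2 * m + 1) ^ 3 <= (6 * h) ^ 3 by rewrite leq_exp2r.
move=> /leq_trans; apply; rewrite expnMn.
by rewrite (_ : 6 ^ 3 = 216) // leq_pmul2l // !expnS expn0 muln1 mulnA.
Qed.

Import GRing.Theory Num.Theory.
Local Open Scope classical_set_scope.
Local Open Scope ring_scope.

(* The size is compared with [n ^ 3] for [n = 2 * m + 1], as [m] tends to
   infinity. *)
Theorem theorem2p8 :
  (forall m : nat, (3 <= 2 * m + 1)%N ->
     [/\ subcube_partition (cubic_family m),
         tight (cubic_family m)
       & irreducible (cubic_family m)]) /\
  (forall R : realType,
     (fun m : nat => #|cubic_family m|%:R : R) =Theta_\oo
     (fun m : nat => (2 * m + 1)%N%:R ^+ 3 : R)).
Proof.
split=> [m m3|R].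
  have m0 : (0 < m)%N by lia.
  split; [exact: cubic_family_partition|exact: cubic_family_tight|].
  exact: cubic_family_irreducible.
rewrite eqThetaE qualifE; apply/asboolP; exists (216%:R^-1, 3%:R) => /=.
  by rewrite invr_gt0 !ltr0n.
exists 1%N => // m /= m0.
rewrite -natrX !normr_nat -natrM ler_nat.
split; last exact: card_cubic_family_le.
rewrite mulrC ler_pdivrMr ?ltr0n // -natrM ler_nat [leqRHS]mulnC.
by rewrite card_cubic_family_ge.
Qed.
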